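(* If models $A$ and $B$ are strongly equivalent, then $A$ is complete if and only if $B$ is complete.
   Context: A model of computation over a set $X$ is any set of functions $f:X\to X\cup\{\bot\}$, where $\bot$ denotes ''undefined''. Injections are extended by $\rho(\bot)=\bot$. $A\succsim_\rho B$ means: for every $g\in B$ there is $f\in A$ with $\rho\circ g=f\circ\rho$; $A\succsim B$ means $A\succsim_\rho B$ for some injection $\rho$. $A$ and $B$ are strongly equivalent if there are bijections $\pi:\mathrm{dom}\,B\to\mathrm{dom}\,A$, $\tau:\mathrm{dom}\,A\to\mathrm{dom}\,B$ with $A\succsim_\pi B$ and $B\succsim_\tau A$. A model $A$ is complete if for every model $M$ over $\mathrm{dom}\,A$ with $M\supseteq A$ and $A\succsim M$, we have $M=A$. *)

(* Defs.v *)
From mathcomp Require Import all_boot.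
From mathcomp Require Import boolp classical_sets.

Set Implicit Arguments.
Unset Strict Implicit.
Unset Printing Implicit Defensive.

Local Open Scope classical_set_scope.

(* [None] plays the role of the undefined value. *)
Definition model (X : Type) := set (X -> option X).

(* [omap rho] is the extension of [rho] that fixes the undefined value. *)
Definition simulates_via (X Y : Type) (rho : Y -> X)
    (A : model X) (B : model Y) : Prop :=
  forall g, B g -> exists2 f, A f & omap rho \o g = f \o rho.

Definition simulates (X Y : Type) (A : model X) (B : model Y) : Prop :=
  exists2 rho : Y -> X, injective rho & simulates_via rho A B.

Definition strongly_equivalent (X Y : Type) (A : model X) (B : model Y) : Prop :=
  exists (pi : Y -> X) (tau : X -> Y),
    [/\ bijective pi, bijective tau, simulates_via pi A B & simulates_via tau B A].

Definition complete_model (X : Type) (A : model X) : Prop :=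
  forall M : model X, A `<=` M -> simulates A M -> M = A.

(* Main.v *)
(* Suppose [A] is complete, and let [M] contain [B] and be simulated by [B] via
   [rho].  Pull [M] back along the bijection [tau] to a model [N] over the
   domain of [A].  Since [B] simulates [A] via [tau], [N] contains [A]; and [A]
   simulates [N] via [pi \o rho \o tau].  Hence [N = A], so every function of
   [M], being conjugate to one of [A], is already in [B]. *)
Require Import Defs.
From mathcomp Require Import all_boot.
From mathcomp Require Import boolp classical_sets.

Set Implicit Arguments.
Unset Strict Implicit.
Unset Printing Implicit Defensive.

Local Open Scope classical_set_scope.

Lemma simulates_via_comp (X Y Z : Type) (rho : Y -> X) (sigma : Z -> Y)
    (A : model X) (B : model Y) (C : model Z) :
  simulates_via rho A B -> simulates_via sigma B C ->
  simulates_via (rho \o sigma) A C.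
Proof.
move=> AB BC h /BC[g /AB[f Af fg] gh]; exists f => //.
apply/funext => z; have := congr1 (@^~ (sigma z)) fg.
have := congr1 (@^~ z) gh => /= <- /= <-.
(* What remains is functoriality of [omap] at [h z]. *)
by case: (h z).
Qed.

Lemma strongly_equivalent_sym (X Y : Type) (A : model X) (B : model Y) :
  strongly_equivalent A B -> strongly_equivalent B A.
Proof. by case=> pi [tau [bpi btau AB BA]]; exists tau, pi. Qed.

(** Intertwining with [tau], rather than conjugation by an inverse, makes membership literally the
    condition that [simulates_via tau M] imposes on each function. *)
Definition pullback_model (X Y : Type) (tau : X -> Y) (M : model Y) : model X :=
  [set f | exists2 m, M m & omap tau \o f = m \o tau].

Lemma complete_pullback (X Y : Type) (tau : X -> Y) (A : model X) (B : model Y) :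
  bijective tau -> simulates_via tau B A -> simulates A B ->
  complete_model A -> complete_model B.
Proof.
move=> [tau' tauK tau'K] BA [pi pi_inj AB] cA M BM [rho rho_inj BrhoM].
have NA : pullback_model tau M = A.
  apply: cA => [f /BA[m /BM Mm fm]|]; first by exists m.
  exists (pi \o (rho \o tau)).
    exact: inj_comp pi_inj (inj_comp rho_inj (can_inj tauK)).
  apply: simulates_via_comp AB _; apply: simulates_via_comp BrhoM _.
  by move=> f.
apply/seteqP; split=> // m Mm.
have conjE : omap tau \o (omap tau' \o m \o tau) = m \o tau.
  by apply/funext => x /=; case: (m _) => //= y; rewrite tau'K.
have : A (omap tau' \o m \o tau) by rewrite -NA; exists m.
case/BA => b Bb; rewrite conjE => mb.
(* Now [m] and [b] agree after precomposition with [tau], which is onto: each [y] is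
   [tau (tau' y)]. *)
suff -> : m = b by [].
by apply/funext => y; have := congr1 (@^~ (tau' y)) mb; rewrite /= tau'K.
Qed.

Lemma complete_strongly_equivalent (X Y : Type) (A : model X) (B : model Y) :
  strongly_equivalent A B -> complete_model A -> complete_model B.
Proof.
case=> pi [tau [/bij_inj pi_inj btau AB BA]].
by apply: (complete_pullback btau) => //; exists pi.
Qed.

Theorem mainTheorem17 (X Y : Type) (A : model X) (B : model Y) :
  strongly_equivalent A B -> (complete_model A <-> complete_model B).
Proof.
move=> AB; split; first exact: complete_strongly_equivalent AB.
exact: complete_strongly_equivalent (strongly_equivalent_sym AB).
Qed.
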